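(* Let $Y$ be a finite set and let $h:D\to Y$ be a function on the unit simplex $D$. Suppose that every level set $L(y)=\{p\in D: h(p)=y\}$, $y\in Y$, can be written as a finite union $L(y)=\bigcup_k C_{y,k}$, where each $C_{y,k}\subseteq D$ can in turn be written as a finite intersection of (subsets of $D$ defined by) linear inequalities of the form $$\alpha_0p_0+\alpha_1p_1+\cdots+\alpha_Kp_K\le\alpha\qquad\text{or}\qquad \alpha_0p_0+\alpha_1p_1+\cdots+\alpha_Kp_K<\alpha$$ with rational coefficients $\alpha,\alpha_0,\alpha_1,\ldots,\alpha_K$. Then $h$ is computable.
   Context: $X=\{0,1,\ldots,K\}$ and $D=\{(p_0,\ldots,p_K)\in[0,1]^{K+1}:\sum_{k=0}^K p_k=1\}$. For $x\in X^n$ let $p_k(x_1,\ldots,x_n)=|\{i:x_i=k\}|/n$. A function $h:D\to Y$ is called computable if the function family $(f_n)_{n=1,2,\ldots}$, $f_n:X^n\to Y$, given by $f_n(x)=h(p_0(x),p_1(x),\ldots,p_K(x))$ is computable in the following sense. Model of computation. $X$ is a finite input set and $Y$ a finite output set. A network is a triple $(n,G,\mathcal L)$ where $n\ge 2$ is the number of nodes, $G=(V,E)$ is a connected bidirectional graph on $V=\{1,\ldots,n\}$ (a directed graph without self-loops such that $(i,j)\in E$ implies $(j,i)\in E$), $d(i)$ is the degree of node $i$ (its in-degree, equal to its out-degree), and $\mathcal L$ is a port labeling: it assigns to the outgoing edges of each node $i$ distinct integers (port numbers) from $\{0,1,\ldots,d(i)\}$. An algorithm is a family of finite automata $(A_d)_{d=1,2,\ldots}$.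 A state of $A_d$ is a tuple $[x,z,y;(m_1,\ldots,m_d)]$ with $x\in X$ (initial value), $z\in Z_d$ (internal memory state), $y\in Y$ (output), $m_1,\ldots,m_d\in M$ (outgoing messages). The sets $Z_d$ (which may depend on $d$) and $M$ are finite. The sets $Y,Z_d,M$ in the state space are assumed to contain a special symbol $\emptyset$ (adjoined if necessary). $A_d$ is identified with a map from $X\times Z_d\times Y\times M^d$ to itself that does not change $x$. Execution: given initial values $x_1,\ldots,x_n\in X$, node $i$ runs $A_{d(i)}$ started at time $0$ with $x=x_i$ and $z=y=m_1=\cdots=m_{d(i)}=\emptyset$. At each node, order the outgoing edges by increasing port number. Let $j_k$ be the node at the other end of the $k$th outgoing edge of $i$, and let $p_k$ (in this paragraph) be the position of the edge $(j_k,i)$ in the ordering at $j_k$. For $t=0,1,2,\ldots$ all nodes simultaneously update $$[x_i,z_i(t+1),y_i(t+1);m_{i,1}(t+1),\ldots,m_{i,d(i)}(t+1)]=A_{d(i)}[x_i,z_i(t),y_i(t);m_{j_1,p_1}(t),\ldots,m_{j_{d(i)},p_{d(i)}}(t)].$$ The algorithm terminates with final output $y^*\in Y$ if there is a time $t'$ with $y_i(t)=y^*$ for all nodes $i$ and all $t\ge t'$. A family $(f_n)$, $f_n:X^n\to Y$, is computable if there is an algorithm $(A_d)$ (not depending on $n$ or the network) such that for every $n$, every network $(n,G,\mathcal L)$ and all initial values $x_1,\ldots,x_n\in X$ the algorithm terminates with final output $f_n(x_1,\ldots,x_n)$. *)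

(* Defs.v *)
From HB Require Import structures.
From mathcomp Require Import all_boot all_order all_algebra.
From mathcomp Require Import all_classical all_reals.

Set Implicit Arguments.
Unset Strict Implicit.
Unset Printing Implicit Defensive.

Import Order.TTheory GRing.Theory Num.Theory.

Local Open Scope classical_set_scope.
Local Open Scope ring_scope.

Record network (n : nat) := Network {
  net_size : (2 <= n)%N;
  edge : rel 'I_n;
  edge_irrefl : irreflexive edge;
  edge_sym : symmetric edge;
  edge_connected : forall i j, connect edge i j;
  port : 'I_n -> 'I_n -> nat; (* only meaningful on edges *)
  port_le : forall i j, edge i j -> (port i j <= #|edge i|)%N;
  port_inj : forall i j k,
    edge i j -> edge i k -> port i j = port i k -> j = k
}.

Section Ports.
Variables (n : nat) (N : network n).

Definition degree (i : 'I_n) : nat := #|edge N i|.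

(* Heads of the outgoing edges of i, in increasing order of port number. *)
Definition out_nbrs (i : 'I_n) : seq 'I_n :=
  sort (fun j k => (port N i j <= port N i k)%N) (enum (edge N i)).

Lemma size_out_nbrs i : size (out_nbrs i) = degree i.
Proof. by rewrite size_sort -cardE. Qed.

Lemma mem_out_nbrs i j : (j \in out_nbrs i) = edge N i j.
Proof. by rewrite mem_sort mem_enum. Qed.

Definition nbr (i : 'I_n) (k : 'I_(degree i)) : 'I_n := nth i (out_nbrs i) k.

Lemma edge_nbr i (k : 'I_(degree i)) : edge N i (nbr k).
Proof. by rewrite -mem_out_nbrs mem_nth // size_out_nbrs. Qed.

Lemma back_port_subproof i (k : 'I_(degree i)) :
  (index i (out_nbrs (nbr k)) < degree (nbr k))%N.
Proof.
by rewrite -size_out_nbrs index_mem mem_out_nbrs edge_sym edge_nbr.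
Qed.

(* Position of the reverse edge (nbr k, i) in the ordering at nbr k. *)
Definition back_port (i : 'I_n) (k : 'I_(degree i)) : 'I_(degree (nbr k)) :=
  Ordinal (back_port_subproof k).

End Ports.

Record state (X Z Y M : Type) (d : nat) := State {
  st_init : X;
  st_mem : Z;
  st_out : Y;
  st_msg : {ffun 'I_d -> M}
}.

(* The special symbol is [None] for outputs, [mem0] and [msg0] otherwise.
   The value at d = 0 is irrelevant: every node of a network has degree > 0. *)
Record algorithm (X Y : finType) := Algorithm {
  mem_type : nat -> finType;
  mem0 : forall d, mem_type d;
  msg : finType;
  msg0 : msg;
  automaton : forall d,
    state X (mem_type d) (option Y) msg d -> state X (mem_type d) (option Y) msg d;
  automaton_init : forall d s, st_init (@automaton d s) = st_init s
}.

Section Execution.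
Variables (X Y : finType) (A : algorithm X Y) (n : nat) (N : network n).
Variable x : {ffun 'I_n -> X}.

Fixpoint exec (t : nat) (i : 'I_n) :
    state X (mem_type A (degree N i)) (option Y) (msg A) (degree N i) :=
  if t is t'.+1 then
    automaton (State (x i) (st_mem (exec t' i)) (st_out (exec t' i))
      [ffun k => st_msg (exec t' (nbr k)) (back_port k)])
  else State (x i) (mem0 A (degree N i)) None [ffun=> msg0 A].

Definition terminates_with (y : Y) : Prop :=
  exists t0 : nat, forall t i, (t0 <= t)%N -> st_out (exec t i) = Some y.

End Execution.

(* [f m] is the member of the family with m + 1 arguments. *)
Definition computable_family (X Y : finType)
    (f : forall m, {ffun 'I_m.+1 -> X} -> Y) : Prop :=
  exists A : algorithm X Y,
    forall m (N : network m.+1) (x : {ffun 'I_m.+1 -> X}),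
      terminates_with A N x (f m x).

Definition in_simplex (R : realType) (K : nat) (p : {ffun 'I_K.+1 -> R}) :=
  [forall k, 0 <= p k <= 1] && (\sum_k p k == 1).

Definition simplex (R : realType) (K : nat) : Type :=
  {p : {ffun 'I_K.+1 -> R} | in_simplex p}.

Definition freq (R : realType) (K m : nat) (x : {ffun 'I_m.+1 -> 'I_K.+1}) :
    {ffun 'I_K.+1 -> R} :=
  [ffun k => #|[set i | x i == k]%SET|%:R / m.+1%:R].

Lemma freq_in_simplex (R : realType) (K m : nat)
  (x : {ffun 'I_m.+1 -> 'I_K.+1}) : in_simplex (freq R x).
Proof.
apply/andP; split.
  apply/forallP => k; rewrite ffunE divr_ge0 ?ler0n //=.
  rewrite ler_pdivrMr ?ltr0Sn // mul1r ler_nat.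
  by rewrite (leq_trans (max_card _)) // card_ord.
under eq_bigr do rewrite ffunE.
rewrite -mulr_suml -natr_sum.
have -> : (\sum_(k < K.+1) #|[set i | x i == k]%SET| = m.+1)%N.
  transitivity (\sum_(i : 'I_m.+1) 1)%N; last by rewrite sum1_card card_ord.
  rewrite (partition_big x predT) //=.
  by apply: eq_bigr => k _; rewrite sum1dep_card.
by rewrite divff // pnatr_eq0.
Qed.

Definition computable (R : realType) (K : nat) (Y : finType)
    (h : simplex R K -> Y) : Prop :=
  computable_family (fun m (x : {ffun 'I_m.+1 -> 'I_K.+1}) =>
    h (exist _ (freq R x) (freq_in_simplex R x))).

Definition linear_form (R : realType) (K : nat) (a : 'I_K.+1 -> rat)
    (p : simplex R K) : R :=
  \sum_k ratr (a k) * \val p k.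

Definition rational_halfspace (R : realType) (K : nat)
    (H : set (simplex R K)) : Prop :=
  exists (a : 'I_K.+1 -> rat) (b : rat),
    H = [set p | linear_form a p <= ratr b] \/
    H = [set p | linear_form a p < ratr b].

Definition finite_halfspace_inter (R : realType) (K : nat)
    (C : set (simplex R K)) : Prop :=
  exists (s : nat) (H : 'I_s -> set (simplex R K)),
    (forall i, rational_halfspace (H i)) /\ C = \bigcap_i H i.

(* Main.v *)
Require Import Defs.
From mathcomp Require Import all_boot all_order all_algebra.
From mathcomp Require Import all_classical all_reals.
From mathcomp Require Import zify ring.

Local Open Scope classical_set_scope.

Set Implicit Arguments.
Unset Strict Implicit.
Unset Printing Implicit Defensive.

(** The level sets of [h] only depend on the signs of finitely many rational
    linear forms at [p], and on frequencies such a sign is the answer to a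
    threshold question: with natural weights [u] and a natural bound [B], is
    the sum of the weights of the [n] nodes greater than [n * B]?  So one
    automaton answering all these questions in parallel computes [h].

    A threshold question is answered by circulating tokens.  Each node keeps a
    stock, initially its weight, and gives away whatever exceeds [B] as unit
    tokens, at most one per port and per step.  Tokens leave through the ports
    in round-robin order (a rotor-router), hence a node that sends infinitely
    often sends infinitely often on each of its ports.  A node cannot receive
    infinitely often without sending infinitely often, since its stock stops
    growing at [B]; by connectedness, either every node sends tokens forever or
    all tokens are eventually swallowed.  As the total of stocks and tokens is
    conserved, the former happens exactly when the total exceeds [n * B]
    ([positive_all_send], [nonpositive_silent]).

    A node that sees no token cannot tell whether one will still come, so the
    negative answer needs its own messengers.  When the total is at most
    [n * B], some node never sends a token ([all_sent_total]): a node that has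
    sent keeps a stock of at least [B], so if all nodes had sent, then at the
    last of these first emissions the total would exceed [n * B].
    A node that has not sent any token therefore acts as a source of signals,
    sending one on each port at each step.  Other nodes forward signals as
    rotor-routers, except that a node marked positive consumes the signals
    that reach it and becomes unmarked; sending a token marks a node.  With no
    tokens left and a source alive, signals reach every node and all marks
    disappear ([nonpositive_mark]).  With tokens circulating forever, all
    sources stop, the number of signals cannot increase, and a surviving signal
    would have to visit a freshly marked node, where it dies; so signals
    vanish and the marks stay ([positive_mark]).  The mark is the answer. *)

(** * Events that occur infinitely often *)

Definition inf_often (P : nat -> bool) :=
  forall t0, exists2 t, t0 <= t & P t.

Lemma not_inf_often (P : nat -> bool) :
  ~ inf_often P -> \forall t \near \oo, ~~ P t.
Proof.
move=> /existsNP[t0 nP]; exists t0 => // t /= t0t; apply/negP => Pt.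
by apply: nP; exists t.
Qed.

Lemma inf_often_near (P : nat -> bool) (Q : nat -> Prop) :
  inf_often P -> (\forall t \near \oo, Q t) ->
  forall t0, exists t, [/\ t0 <= t, P t & Q t].
Proof.
move=> ioP [t1 _ Qt1] t0; have [t] := ioP (maxn t0 t1).
by rewrite geq_max => /andP[? /Qt1 ? ?]; exists t.
Qed.

Lemma inf_oftenS (P Q : nat -> bool) :
  inf_often P -> (\forall t \near \oo, P t -> Q t) -> inf_often Q.
Proof.
move=> ioP PQ t0; have [t [t0t Pt /(_ Pt) Qt]] := inf_often_near ioP PQ t0.
by exists t.
Qed.

Lemma inf_often_exists (V : finType) (P : nat -> V -> bool) :
  inf_often (fun t => [exists i, P t i]) -> exists i, inf_often (P^~ i).
Proof.
move=> ioP; apply: contrapT => /forallNP nP.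
have /filter_forall nPV i : \forall t \near \oo, ~~ P t i.
  by apply: not_inf_often; apply: nP.
have [t [_ /existsP[i Pti] /(_ i)]] := inf_often_near ioP nPV 0.
by rewrite Pti.
Qed.

Lemma inf_often_shift (P : nat -> bool) :
  inf_often (fun t => P t.+1) -> inf_often P.
Proof.
by move=> ioP t0; have [t t0t Pt] := ioP t0; exists t.+1; rewrite // ltnW.
Qed.

(** The termination argument for three measures: the room left in a stock, the
    position of a port in the round-robin queue, and the number of signals in
    the network. *)
Lemma nonincreasing_drops (f : nat -> nat) :
  (\forall t \near \oo, f t.+1 <= f t) -> ~ inf_often (fun t => f t.+1 < f t).
Proof.
move=> [t0 _ fle] drops.
have {}fle t s : t0 <= t -> t <= s -> f s <= f t.
  move=> t0t; elim: s => [|s IH]; first by rewrite leqn0 => /eqP ->.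
  rewrite leq_eqVlt => /predU1P[-> //|]; rewrite ltnS => ts.
  exact: leq_trans (fle s (leq_trans t0t ts)) (IH ts).
suff below k : exists2 t, t0 <= t & f t + k <= f t0.
  by have [t _] := below (f t0).+1; lia.
elim: k => [|k [t t0t IH]]; first by exists t0; rewrite ?addn0.
have [s ts fs] := drops t; exists s.+1; first by lia.
have := fle t s t0t ts; lia.
Qed.

(** How the bits of a node stabilize: [P] forces [Q] infinitely often, and
    eventually nothing undoes it. *)
Lemma absorbed (P Q : nat -> bool) : inf_often P ->
    (\forall t \near \oo, P t -> Q t.+1) ->
    (\forall t \near \oo, Q t -> Q t.+1) ->
  \forall t \near \oo, Q t.
Proof.
move=> ioP PQ [t0 _ QS].
have [t [t0t Pt /(_ Pt) Qt]] := inf_often_near ioP PQ t0.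
exists t.+1 => //; elim=> [|s IH] //=; rewrite leq_eqVlt => /predU1P[<- //|ts].
by apply: QS (IH ts) => /=; lia.
Qed.

(** * Circulating tokens in a connected graph *)

Section TokenFlow.
Variables (V : finType) (e : rel V).

(** What the dynamics below uses of the rotor-routers: nothing is lost between
    sending and receiving, and a node that sends infinitely often reaches each
    of its neighbours infinitely often. *)
Record token_flow (sent recv : nat -> V -> nat) := TokenFlow {
  flow_init : forall i, recv 0 i = 0;
  flow_total : forall t, \sum_i recv t.+1 i = \sum_i sent t i;
  flow_fair : forall i j, e i j ->
    inf_often (fun t => 0 < sent t i) -> inf_often (fun t => 0 < recv t j) }.

Arguments flow_fair {sent recv} _ {i j}.

Hypothesis e_connected : forall i j, connect e i j.

Lemma connected_spread (Q : V -> Prop) i j :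
  (forall i j, e i j -> Q i -> Q j) -> Q i -> Q j.
Proof.
move=> Qe; have /connectP[p] := e_connected i j.
elim: p i => [|k p IH] i /= => [_ -> //|/andP[eik kp] lastj Qi].
exact: IH kp lastj (Qe _ _ eik Qi).
Qed.

(** Fairness moves perpetual activity across one edge, [pass] through one
    node; connectedness does the rest. *)
Lemma flow_everywhere sent recv (F : token_flow sent recv) :
  (forall i, inf_often (fun t => 0 < recv t i) ->
             inf_often (fun t => 0 < sent t i)) ->
  inf_often (fun t => [exists i, 0 < sent t i]) ->
  forall i, inf_often (fun t => 0 < sent t i).
Proof.
move=> pass /inf_often_exists[i0 sent_i0] i.
apply: (@connected_spread (fun i => inf_often (fun t => 0 < sent t i)) i0 i)
  => //.
by move=> j k ejk sj; apply: pass; exact: (flow_fair F ejk sj).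
Qed.

(** [u] is the stock, [c] and [r] count the tokens sent and received.  The
    truncated subtraction makes [c] vanish while [u + r] is at most [B]. *)
Section ThresholdDynamics.
Variables (B : nat) (deg : V -> nat).
Variables (u c r : nat -> V -> nat) (flow : token_flow c r).
Hypothesis deg_gt0 : forall i, 0 < deg i.
Hypothesis cE : forall t i, c t i = minn (u t i + r t i - B) (deg i).
Hypothesis uS : forall t i, u t.+1 i = u t i + r t i - c t i.

(** Stocks together with the tokens just received account for everything. *)
Lemma stock_total t : \sum_i (u t i + r t i) = \sum_i u 0 i.
Proof.
elim: t => [|t IH].
  by apply: eq_bigr => i _; rewrite (flow_init flow) addn0.
rewrite big_split /= (flow_total flow) -big_split -IH /=.
by apply: eq_bigr => i _; rewrite uS cE; lia.
Qed.

Lemma stock_ge t s i : t <= s -> B <= u t i -> B <= u s i.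
Proof.
move=> + But; elim: s => [|s IH]; first by rewrite leqn0 => /eqP <-.
rewrite leq_eqVlt => /predU1P[<- //|]; rewrite ltnS => /IH.
by rewrite uS cE; lia.
Qed.

Lemma stock_ge_sent t s i : t < s -> 0 < c t i -> B <= u s i.
Proof. by move=> ts ct; apply: stock_ge ts _; move: ct; rewrite uS cE; lia. Qed.

(** A node that stays silent stores what it receives, which its stock can do
    only as long as it is below [B]. *)
Lemma pass_positive i :
  inf_often (fun t => 0 < r t i) -> inf_often (fun t => 0 < c t i).
Proof.
move=> io_r; apply: contrapT => /not_inf_often c0.
apply: (@nonincreasing_drops (fun t => B - u t i)).
  by apply: filterS c0 => t; rewrite uS cE; have := deg_gt0 i; lia.
apply: inf_oftenS io_r _; apply: filterS c0 => t.
by rewrite uS cE; have := deg_gt0 i; lia.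
Qed.

(** Look at a time [T i1] by which every node has sent and at which [i1] is
    sending: the other nodes hold at least [B] because they have sent or are
    sending, and [i1] holds more than [B]. *)
Lemma all_sent_total (i0 : V) :
  (forall i, exists t, 0 < c t i) -> #|V| * B < \sum_i u 0 i.
Proof.
move=> /choice[T cT].
pose i1 := [arg max_(i > i0) T i]; have maxT i : T i <= T i1.
  by rewrite /i1; case: arg_maxnP => // j _ /(_ i); apply.
rewrite -(stock_total (T i1)) (bigD1 i1) //=.
have -> : #|V| * B = B + \sum_(i | i != i1) B.
  by rewrite -sum_nat_const [LHS](bigD1 i1).
rewrite -addSn leq_add //; first by have := cT i1; rewrite cE; lia.
apply: leq_sum => i _; have := maxT i; rewrite leq_eqVlt => /predU1P[<-|Ti].
  by have := cT i; rewrite cE; lia.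
exact: leq_trans (stock_ge_sent Ti (cT i)) (leq_addr _ _).
Qed.

Lemma positive_all_send : #|V| * B < \sum_i u 0 i ->
  forall i, inf_often (fun t => 0 < c t i).
Proof.
move=> pos; apply: (flow_everywhere flow pass_positive).
apply: contrapT => /not_inf_often [t _ /(_ t (leqnn t))] /existsPn c0.
move: pos; rewrite ltnNge -(stock_total t) -sum_nat_const; case/negP.
by apply: leq_sum => i _; have := c0 i; rewrite cE; have := deg_gt0 i; lia.
Qed.

(** Perpetual activity would spread to all nodes, contradicting
    [all_sent_total]. *)
Lemma nonpositive_silent (i0 : V) : \sum_i u 0 i <= #|V| * B ->
  \forall t \near \oo, forall i, c t i = 0.
Proof.
move=> nonpos.
have /not_inf_often c0 : ~ inf_often (fun t => [exists i, 0 < c t i]).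
  move=> /(flow_everywhere flow pass_positive) io_c.
  suff : #|V| * B < \sum_i u 0 i by rewrite ltnNge nonpos.
  by apply: (all_sent_total i0) => i; have [t _] := io_c i 0; exists t.
by apply: filterS c0 => t /existsPn c0 i; have := c0 i; lia.
Qed.

(** Signals: [c'] and [r'] count those sent and received.  A node is a source
    until it is [started], that is, until it sends its first token. *)
Variables (started mark : nat -> V -> bool).
Hypothesis e_sym : symmetric e.
Hypothesis e_deg : forall i, exists j, e i j.
Hypothesis started0 : forall i, started 0 i = false.
Hypothesis startedS : forall t i, started t.+1 i = started t i || (0 < c t i).
Variables (c' r' : nat -> V -> nat) (flow' : token_flow c' r').
Hypothesis c'E : forall t i, c' t i =
  if ~~ started t.+1 i then deg i
  else if (0 < c t i) || mark t i then 0 else r' t i.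
Hypothesis markS : forall t i,
  mark t.+1 i = (0 < c t i) || (mark t i && (r' t i == 0)).

Lemma never_started i : (forall t, c t i = 0) -> forall t, ~~ started t i.
Proof.
by move=> c0; elim=> [|t IH]; rewrite ?started0 // startedS c0 orbF.
Qed.

Lemma inf_often_send_started i : inf_often (fun t => 0 < c t i) ->
  \forall t \near \oo, started t i.
Proof.
by move=> /absorbed; apply; near=> t; rewrite startedS => ->; rewrite ?orbT.
Unshelve. all: by end_near. Qed.

(** Once tokens are gone, the first signal received clears a mark for good, and
    from then on the node forwards signals; so signals spread from a permanent
    source to the whole graph. *)
Lemma nonpositive_mark (i0 : V) : \sum_i u 0 i <= #|V| * B ->
  \forall t \near \oo, forall i, ~~ mark t i.
Proof.
move=> nonpos; have silent := nonpositive_silent i0 nonpos.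
have [src src0] : exists i, forall t, c t i = 0.
  apply: contrapT => /forallNP all_sent; move: nonpos; rewrite leqNgt.
  case/negP; apply: (all_sent_total i0) => i.
  by have /existsNP[t ct] := all_sent i; exists t; lia.
have cleared i : inf_often (fun t => 0 < r' t i) ->
    \forall t \near \oo, ~~ mark t i.
  move=> /absorbed; apply; apply: filterS silent => t c0.
    by rewrite markS c0 => rt; rewrite negb_and; lia.
  by rewrite markS c0; case: (mark t i).
have sources_send i : (forall t, ~~ started t i) ->
    inf_often (fun t => 0 < c' t i).
  by move=> idle t; exists t; rewrite // c'E idle.
have all_send i : inf_often (fun t => 0 < c' t i).
  apply: (@connected_spread (fun i => inf_often (fun t => 0 < c' t i)) src i).
    move=> {}i j eij /(flow_fair flow' eij) io_r'.
    have [idle|/existsNP[t0 /negP /negPn st]] :=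
      pselect (forall t, ~~ started t j); first exact: sources_send.
    have {}st : \forall t \near \oo, started t.+1 j.
      exists t0 => //; elim=> [|s IH] /=.
        by rewrite leqn0 => /eqP t00; rewrite startedS -t00 st.
      by rewrite leq_eqVlt startedS => /predU1P[<-|/IH ->//]; rewrite st.
    apply: inf_oftenS (io_r') _; move: st silent (cleared j io_r').
    by apply: filterS3 => t st c0 /negPf unmarked; rewrite c'E st c0 unmarked.
  exact/sources_send/never_started.
apply: filter_forall => i; apply: cleared.
have [j eij] := e_deg i; rewrite e_sym in eij.
exact: (flow_fair flow' eij (all_send j)).
Qed.

(** Once all nodes have started, signals are only forwarded or consumed, so
    from some time on none is consumed.  Signals circulating after that time
    would visit every node infinitely often, including when it is marked. *)
Lemma positive_mark (i0 : V) : #|V| * B < \sum_i u 0 i ->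
  \forall t \near \oo, forall i, mark t i.
Proof.
move=> /positive_all_send io_c.
have no_source : \forall t \near \oo, forall i, started t i.
  by apply: filter_forall => i; apply: inf_often_send_started.
have c'_le : \forall t \near \oo, forall i, c' t i <= r' t i.
  apply: filterS no_source => t st i.
  by rewrite c'E startedS st /=; case: ifP.
have no_absorption : \forall t \near \oo, forall i, c' t i = r' t i.
  have /not_inf_often : ~ inf_often (fun t => [exists i, c' t i < r' t i]).
    move=> drop.
    apply: (@nonincreasing_drops (fun t => \sum_i r' t i)).
      apply: filterS c'_le => t le_t; rewrite (flow_total flow').
      by apply: leq_sum => i _.
    apply: inf_oftenS drop _; apply: filterS c'_le => t le_t /existsP[i lt_i].
    rewrite (flow_total flow') (bigD1 i) //= [ltnRHS](bigD1 i) //= -addSn.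
    by apply: leq_add => //; apply: leq_sum => j _.
  move: c'_le; apply: filterS2 => t c'_le /existsPn/= ge i.
  by apply/eqP; rewrite eqn_leq c'_le leqNgt ge.
have c'0 : \forall t \near \oo, forall i, c' t i = 0.
  have pass i : inf_often (fun t => 0 < r' t i) ->
      inf_often (fun t => 0 < c' t i).
    by move=> /inf_oftenS; apply; apply: filterS no_absorption => t ->.
  have [/(flow_everywhere flow' pass) all_send|/not_inf_often] :=
    pselect (inf_often (fun t => [exists i, 0 < c' t i])); last first.
    by apply: filterS => t /existsPn c0 i; have := c0 i; lia.
  have io_r' i : inf_often (fun t => 0 < r' t i).
    have [j eij] := e_deg i.
    by rewrite e_sym in eij; exact: (flow_fair flow' eij (all_send j)).
  have marked i : \forall t \near \oo, mark t i.
    apply: (absorbed (io_c i)); first by near=> t; rewrite markS => ->.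
    move: no_absorption no_source; apply: filterS2 => t /(_ i) + st mk.
    rewrite c'E markS mk orbT startedS st /= => r0.
    by rewrite -r0 eqxx orbT.
  have [t [_ + [absorbs [st mk]]]] := inf_often_near (io_r' i0)
    (filterI no_absorption (filterI no_source (marked i0))) 0.
  by rewrite -absorbs c'E mk orbT startedS st.
have r'0 i : \forall t \near \oo, r' t i = 0.
  case: c'0 => t0 _ c'0; exists t0.+1 => //; case=> // t /= t0t.
  apply/eqP; rewrite -leqn0 -(@big1_eq _ _ addn V (index_enum V) xpredT).
  rewrite -[leqRHS](eq_bigr _ (fun i _ => c'0 t t0t i)).
  by rewrite -(flow_total flow') (bigD1 i) //= leq_addr.
apply: filter_forall => i; apply: (absorbed (io_c i)).
  by near=> t; rewrite markS => ->.
by apply: filterS (r'0 i) => t r0 mk; rewrite markS mk r0 orbT.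
Unshelve. all: by end_near. Qed.

Lemma mark_correct (i0 : V) :
  \forall t \near \oo, forall i, mark t i = (#|V| * B < \sum_i u 0 i).
Proof.
have [pos|nonpos] := ltnP.
  by apply: filterS (positive_mark i0 pos) => t mk i; rewrite mk.
by apply: filterS (nonpositive_mark i0 nonpos) => t mk i; exact: negbTE (mk i).
Qed.

End ThresholdDynamics.
End TokenFlow.

(** * Rotor-routers on port-labelled networks *)

(** The queue lists the ports in the order of their next use; [sent t] tokens
    leave through its first ports, which then go to the back. *)
Section Rotor.
Variables (d : nat) (rotor : nat -> d.-tuple 'I_d) (sent : nat -> nat).
Hypothesis rotor0 : uniq (rotor 0).
Hypothesis rotorS : forall t, rotor t.+1 = rot_tuple (sent t) (rotor t).
Hypothesis sent_le : forall t, sent t <= d.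

Lemma rotor_uniq t : uniq (rotor t).
Proof. by elim: t => // t IH; rewrite rotorS rot_uniq. Qed.

Lemma mem_rotor t k : k \in rotor t.
Proof.
have [||_ ->] := uniq_min_size (rotor_uniq t) (s2 := enum 'I_d).
- by move=> i _; rewrite mem_enum.
- by rewrite size_enum_ord size_tuple.
by rewrite mem_enum.
Qed.

Lemma card_rotor_take t :
  #|[set k | k \in take (sent t) (rotor t)]%SET| = sent t.
Proof.
rewrite cardsE; have /card_uniqP -> := take_uniq (sent t) (rotor_uniq t).
by rewrite size_takel // size_tuple.
Qed.

(** As long as port [k] is missed, it moves up in the queue by the number of
    tokens sent. *)
Lemma rotor_fair k : inf_often (fun t => 0 < sent t) ->
  inf_often (fun t => k \in take (sent t) (rotor t)).
Proof.
move=> io_sent; apply: contrapT => /not_inf_often missed.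
have approach : \forall t \near \oo,
    index k (rotor t) = sent t + index k (rotor t.+1).
  apply: filterS missed => t /negPf miss; rewrite rotorS /= /rot.
  have kd : k \in drop (sent t) (rotor t).
    have : k \in take (sent t) (rotor t) ++ drop (sent t) (rotor t).
      by rewrite cat_take_drop mem_rotor.
    by rewrite mem_cat miss.
  rewrite -[in LHS](cat_take_drop (sent t) (rotor t)) !index_cat miss kd.
  by rewrite size_takel // size_tuple.
apply: (@nonincreasing_drops (fun t => index k (rotor t))).
  by apply: filterS approach => t ->; rewrite leq_addl.
by apply: inf_oftenS io_sent _; apply: filterS approach => t -> ?; lia.
Qed.
End Rotor.

Section PortFlow.
Variables (n : nat) (N : network n).

Lemma out_nbrs_uniq i : uniq (out_nbrs N i).
Proof. by rewrite sort_uniq enum_uniq. Qed.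

Lemma nbr_inj i : injective (@nbr n N i).
Proof.
move=> k k' /eqP; rewrite nth_uniq ?size_out_nbrs ?out_nbrs_uniq //.
by move=> /eqP /val_inj.
Qed.

Lemma nbr_surj i j : edge N i j -> exists k : 'I_(degree N i), nbr k = j.
Proof.
rewrite -mem_out_nbrs => ij.
have lt_ij : index j (out_nbrs N i) < degree N i.
  by rewrite -size_out_nbrs index_mem.
by exists (Ordinal lt_ij); rewrite /nbr /= nth_index.
Qed.

Lemma nbr_back_port i (k : 'I_(degree N i)) : nbr (back_port k) = i.
Proof. by rewrite /nbr /= nth_index // mem_out_nbrs edge_sym edge_nbr. Qed.

(** [crossed i j] tells whether a message travels from [i] to [j]; summing it
    by rows or by columns counts the messages sent or received by a node. *)
Variable msg : forall i : 'I_n, 'I_(degree N i) -> bool.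
Let crossed i j := [exists k : 'I_(degree N i), (nbr k == j) && msg k].

Lemma card_sent i : \sum_j crossed i j = #|[set k | @msg i k]%SET|.
Proof.
rewrite -(card_imset _ (@nbr_inj i)) -sum1_card [RHS]big_mkcond /=.
apply: eq_bigr => j _; rewrite (_ : (j \in _) = crossed i j).
  by case: crossed.
apply/imsetP/existsP => [[k]|[k /andP[/eqP <- mk]]].
  by rewrite inE => mk ->; exists k; rewrite eqxx.
by exists k; rewrite ?inE.
Qed.

Lemma card_received i : \sum_j crossed j i =
  #|[set k : 'I_(degree N i) | msg (back_port k)]%SET|.
Proof.
rewrite -(card_imset _ (@nbr_inj i)) -sum1_card [RHS]big_mkcond /=.
apply: eq_bigr => j _; rewrite (_ : (j \in _) = crossed j i).
  by case: crossed.
apply/imsetP/existsP => [[k]|[k /andP[/eqP ki mk]]].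
  by rewrite inE => mk ->; exists (back_port k); rewrite nbr_back_port eqxx.
have /nbr_surj[k' k'j] : edge N i j by rewrite edge_sym -ki edge_nbr.
subst j; exists k' => //; rewrite inE.
by rewrite (_ : back_port k' = k) //; apply: nbr_inj; rewrite nbr_back_port.
Qed.
End PortFlow.

Lemma exists_nbr m (N : network m.+1) i : exists j, edge N i j.
Proof.
have [j ij] : exists j, i != j.
  have [->|i0] := eqVneq i ord0; last by exists ord0.
  exists ord_max; rewrite -val_eqE /=; have := net_size N; lia.
have /connectP[[|k p] /= ] := edge_connected N i j.
  by move=> _ ji; rewrite ji eqxx in ij.
by move=> /andP[ik _] _; exists k.
Qed.

(** Conservation is a double count over directed edges; fairness combines that
    of the port queue at the sender with the identification of its ports with
    its neighbours. *)
Lemma port_flow n (N : network n)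
  (msg : nat -> forall i : 'I_n, 'I_(degree N i) -> bool)
  (rotor : nat -> forall i : 'I_n, (degree N i).-tuple 'I_(degree N i))
  (sent recv : nat -> 'I_n -> nat) :
  (forall i k, msg 0 i k = false) ->
  (forall t i k, msg t.+1 i k = (k \in take (sent t i) (rotor t i))) ->
  (forall i, uniq (rotor 0 i)) ->
  (forall t i, rotor t.+1 i = rot_tuple (sent t i) (rotor t i)) ->
  (forall t i, sent t i <= degree N i) ->
  (forall t i, recv t i =
     #|[set k : 'I_(degree N i) | msg t (nbr k) (back_port k)]%SET|) ->
  token_flow (edge N) sent recv.
Proof.
move=> msg0 msgS rotor0 rotorS sent_le recvE; split.
- move=> i; rewrite recvE (_ : finset _ = finset.set0) ?finset.cards0 //.
  by apply/setP => k; rewrite !inE msg0.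
- move=> t; under eq_bigr do rewrite recvE -(card_received (msg t.+1)).
  rewrite exchange_big /=; apply: eq_bigr => i _; rewrite card_sent.
  rewrite -[RHS](card_rotor_take (rotor0 i) (fun t => rotorS t i)
    (sent_le^~ i)).
  by apply: eq_card => k; rewrite !inE msgS.
- move=> i j; rewrite edge_sym => /nbr_surj[k <-{i}] io_sent.
  have io_k := rotor_fair (rotor0 _) (fun t => rotorS t _) (sent_le^~ _)
    (back_port k) io_sent.
  apply: inf_often_shift; apply: inf_oftenS io_k _.
  near=> t; rewrite -msgS => mk; rewrite recvE card_gt0.
  by apply/set0Pn; exists k; rewrite inE.
Unshelve. all: by end_near. Qed.

(** * The automaton *)

(** The memory of a node of degree [d] for one threshold question: stock,
    whether a token was ever sent, mark, and the port queues of tokens and of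
    signals.  Unprimed names refer to tokens, primed ones to signals.  Since a
    node receives at most [d] tokens and sends up to [d] of them when it has
    any excess, the stock never exceeds its initial bound [2 * B]. *)
Section Cell.
Variables (B d : nat).

Definition cell : finType :=
  ('I_B.*2.+1 * bool * bool * d.-tuple 'I_d * d.-tuple 'I_d)%type.

Definition stock (z : cell) : nat := z.1.1.1.1.
Definition started (z : cell) := z.1.1.1.2.
Definition mark (z : cell) := z.1.1.2.
Definition rotor (z : cell) := z.1.2.
Definition rotor' (z : cell) := z.2.

Definition new_cell (u : 'I_B.*2.+1) : cell :=
  (u, false, false, ord_tuple d, ord_tuple d).

Section Step.
Variables (z : cell) (r r' : nat).

Definition sent := minn (stock z + r - B) d.
Definition sent' :=
  if ~~ (started z || (0 < sent)) then d
  else if (0 < sent) || mark z then 0 else r'.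

Definition step : cell :=
  (inord (stock z + r - sent), started z || (0 < sent),
   (0 < sent) || (mark z && (r' == 0)),
   rot_tuple sent (rotor z), rot_tuple sent' (rotor' z)).

Definition outgoing (k : 'I_d) : bool * bool :=
  (k \in take sent (rotor z), k \in take sent' (rotor' z)).

Lemma stock_step : r <= d -> stock step = stock z + r - sent.
Proof.
move=> rd; rewrite /stock /= inordK // /sent.
have := ltn_ord z.1.1.1.1; rewrite -/(stock z); lia.
Qed.

Lemma sent'_le : r' <= d -> sent' <= d.
Proof. by move=> r'd; rewrite /sent'; do ![case: ifP => _]. Qed.

End Step.
End Cell.

Section Threshold.
Variables (X Y J : finType) (B : nat) (weight : J -> X -> 'I_B.*2.+1).
Variable output : {ffun J -> bool} -> Y.

Definition start d (x : X) : {ffun J -> cell B d} :=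
  [ffun j => new_cell d (weight j x)].

Definition received d (m : {ffun 'I_d -> {ffun J -> bool * bool}}) j :=
  #|[set k | (m k j).1]%SET|.
Definition received' d (m : {ffun 'I_d -> {ffun J -> bool * bool}}) j :=
  #|[set k | (m k j).2]%SET|.

(** The initial memory does not depend on the input, so the cells are filled
    in at the first step. *)
Definition cells d (x : X) (z : option {ffun J -> cell B d}) :=
  odflt (start d x) z.

Definition threshold_step d
    (s : state X (option {ffun J -> cell B d}) (option Y)
           {ffun J -> bool * bool} d) :=
  let z := cells (st_init s) (st_mem s) in
  let r := received (st_msg s) in
  let r' := received' (st_msg s) in
  let z1 := [ffun j => step (z j) (r j) (r' j)] in
  State (st_init s) (Some z1) (Some (output [ffun j => mark (z1 j)]))
    [ffun k => [ffun j => outgoing (z j) (r j) (r' j) k]].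

Definition threshold_algorithm : algorithm X Y :=
  @Algorithm X Y (fun d => option {ffun J -> cell B d}) (fun=> None)
    {ffun J -> bool * bool} [ffun=> (false, false)] threshold_step
    (fun d s => erefl).

Section Run.
Variables (m : nat) (N : network m.+1) (x : {ffun 'I_m.+1 -> X}).
Notation run := (exec threshold_algorithm N x).

Let inbox t i : {ffun 'I_(degree N i) -> {ffun J -> bool * bool}} :=
  [ffun k => st_msg (run t (nbr k)) (back_port k)].
Let cell_at t i j : cell B (degree N i) := cells (x i) (st_mem (run t i)) j.
Let r j t i := received (inbox t i) j.
Let r' j t i := received' (inbox t i) j.
Let c j t i := sent (cell_at t i j) (r j t i).
Let c' j t i := sent' (cell_at t i j) (r j t i) (r' j t i).

Lemma received_le d (b : {ffun 'I_d -> {ffun J -> bool * bool}}) j :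
  received b j <= d /\ received' b j <= d.
Proof. by split; apply: leq_trans (max_card _) _; rewrite card_ord. Qed.

Lemma cell_at0 i j : cell_at 0 i j = new_cell (degree N i) (weight j (x i)).
Proof. by rewrite /cell_at /cells /= ffunE. Qed.

Lemma cell_atS t i j :
  cell_at t.+1 i j = step (cell_at t i j) (r j t i) (r' j t i).
Proof. by rewrite {1}/cell_at /cells /= ffunE. Qed.

Lemma message_sent t i k j :
  st_msg (run t.+1 i) k j = outgoing (cell_at t i j) (r j t i) (r' j t i) k.
Proof. by rewrite /= !ffunE. Qed.

Lemma threshold_flow j : token_flow (edge N) (c j) (r j).
Proof.
apply: (@port_flow _ _ (fun t i k => (st_msg (run t i) k j).1)
  (fun t i => rotor (cell_at t i j))).
- by move=> i k; rewrite /= !ffunE.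
- by move=> t i k; rewrite message_sent.
- move=> i; rewrite cell_at0 -[uniq _]/(uniq (\val (ord_tuple _))).
  by rewrite val_ord_tuple enum_uniq.
- by move=> t i; rewrite cell_atS.
- by move=> t i; rewrite /c /sent geq_minr.
- by move=> t i; apply: eq_card => k; rewrite !inE ffunE.
Qed.

Lemma threshold_flow' j : token_flow (edge N) (c' j) (r' j).
Proof.
apply: (@port_flow _ _ (fun t i k => (st_msg (run t i) k j).2)
  (fun t i => rotor' (cell_at t i j))).
- by move=> i k; rewrite /= !ffunE.
- by move=> t i k; rewrite message_sent.
- move=> i; rewrite cell_at0 -[uniq _]/(uniq (\val (ord_tuple _))).
  by rewrite val_ord_tuple enum_uniq.
- by move=> t i; rewrite cell_atS.
- by move=> t i; apply/sent'_le/(received_le _ _).2.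
- by move=> t i; apply: eq_card => k; rewrite !inE ffunE.
Qed.

Lemma threshold_correct j : \forall t \near \oo, forall i,
  mark (cell_at t i j) = (m.+1 * B < \sum_i weight j (x i)).
Proof.
have := @mark_correct _ (edge N) (edge_connected N) B (degree N)
  (fun t i => stock (cell_at t i j)) _ _ (threshold_flow j) _ _ _
  (fun t i => started (cell_at t i j)) (fun t i => mark (cell_at t i j))
  (edge_sym N) (exists_nbr N) _ _ _ _ (threshold_flow' j) _ _ ord0.
rewrite card_ord (eq_bigr (fun i => nat_of_ord (weight j (x i)))); last first.
  by move=> i _; rewrite cell_at0.
apply => //.
- by move=> i; have [k ik] := exists_nbr N i; apply/card_gt0P; exists k.
- by move=> t i; rewrite cell_atS stock_step // (received_le _ _).1.
- by move=> i; rewrite cell_at0.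
- by move=> t i; rewrite cell_atS.
- by move=> t i; rewrite cell_atS.
- by move=> t i; rewrite cell_atS.
Qed.

End Run.

Theorem threshold_computable : computable_family
  (fun m (x : {ffun 'I_m.+1 -> X}) =>
     output [ffun j => m.+1 * B < \sum_i weight j (x i)]).
Proof.
exists threshold_algorithm => m N x.
have /filter_forall [t0 _ correct] := threshold_correct N x.
exists t0.+1 => -[|t] i //= t0t; congr (Some (output _)).
apply/ffunP => j; rewrite !ffunE.
have := correct t.+1 _ j i; rewrite cell_atS => -> //=; exact: ltnW.
Qed.
End Threshold.

Import Order.TTheory GRing.Theory Num.Theory.
Local Open Scope ring_scope.

(** * Rational polyhedra and threshold questions *)

(** Clearing denominators by [D] and shifting by [B] turns rational weights
    into natural ones, for which a positive sum means a total above [n * B]. *)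
Lemma integral_weights (J T : finType) (w : J -> T -> rat) :
  exists (D B : nat) (u : J -> T -> 'I_B.*2.+1),
    (0 < D)%N /\ forall j k, (u j k)%:R = D%:R * w j k + B%:R :> rat.
Proof.
pose f (s : J * T) := w s.1 s.2.
pose v s : int := numq (f s) * \prod_(s' | s' != s) denq (f s').
pose D := (\prod_s `|denq (f s)|)%N; pose B := (\sum_s `|v s|)%N.
have DvE s : D%:~R * f s = (v s)%:~R :> rat.
  have -> : D%:Z = \prod_s denq (f s).
    by rewrite (big_morph _ PoszM erefl); apply: eq_bigr => s' _;
       rewrite absz_denq.
  by rewrite (bigD1 s) //= /v !intrM numqE; ring.
exists D, B, (fun j k => inord `|v (j, k) + B%:Z|); split.
  by apply: prodn_gt0 => s; rewrite absz_gt0 denq_neq0.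
move=> j k.
have vB : (`|v (j, k)| <= B)%N by rewrite /B (bigD1 (j, k)) //= leq_addr.
rewrite inordK; last by lia.
by rewrite !pmulrn (DvE (j, k)) gez0_abs ?intrD //; lia.
Qed.

Section Determined.
Variables (R : realType) (K : nat).
Implicit Types (p q : simplex R K) (A : set (simplex R K)).
Implicit Types (ws : seq {ffun 'I_K.+1 -> rat}).

Definition agree ws p q :=
  {in ws, forall w : {ffun 'I_K.+1 -> rat},
    (0 < linear_form w p) = (0 < linear_form w q)}.

(** Phrased without naming the Boolean combination, so that unions and
    intersections only need to collect the linear forms involved. *)
Definition determined_by ws A := forall p q, agree ws p q -> A p -> A q.

Lemma determined_family (I : finType) (A : I -> set (simplex R K)) :
  (forall i, exists ws, determined_by ws (A i)) ->
  exists ws, forall i, determined_by ws (A i).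
Proof.
move=> /choice[ws wsP]; exists (flatten [seq ws i | i : I]) => i p q pq.
apply: wsP => w wi; apply: pq; apply/flatten_mapP; exists i => //.
by rewrite mem_enum.
Qed.

(** The coordinates of a point of the simplex sum to 1, so affine inequalities
    are homogeneous ones. *)
Lemma linear_form_subr (a : 'I_K.+1 -> rat) (b : rat) p :
  linear_form [ffun k => a k - b] p = linear_form a p - ratr b.
Proof.
have /andP[_ /eqP p1] := svalP p; rewrite /linear_form.
rewrite -[ratr b]mulr1 -p1 mulr_sumr -sumrB; apply: eq_bigr => k _.
by rewrite ffunE rmorphB /= mulrBl.
Qed.

Lemma linear_form_opp (a : {ffun 'I_K.+1 -> rat}) p :
  linear_form [ffun k => - a k] p = - linear_form a p.
Proof.
rewrite /linear_form -sumrN; apply: eq_bigr => k _.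
by rewrite ffunE rmorphN mulNr.
Qed.

Lemma halfspace_determined (H : set (simplex R K)) :
  rational_halfspace H -> exists ws, determined_by ws H.
Proof.
move=> [a [b [->|->]]].
  exists [:: [ffun k => a k - b]] => p q /(_ _ (mem_head _ _)).
  by rewrite !linear_form_subr !subr_gt0 /= ![_ <= _]leNgt => ->.
exists [:: [ffun k => - [ffun k => a k - b] k]] => p q /(_ _ (mem_head _ _)).
by rewrite !linear_form_opp !linear_form_subr !oppr_gt0 !subr_lt0 /= => ->.
Qed.

Lemma halfspace_inter_determined C :
  @finite_halfspace_inter R K C -> exists ws, determined_by ws C.
Proof.
move=> [s [H [Hh ->]]].
have [ws wsH] := determined_family (fun i => halfspace_determined (Hh i)).
by exists ws => p q pq Hp i _; apply: wsH pq _; apply: Hp.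
Qed.

Lemma levels_determined (Y : finType) (h : simplex R K -> Y) :
  (forall y : Y, exists (r : nat) (C : 'I_r -> set (simplex R K)),
      (forall k, finite_halfspace_inter (C k)) /\
      [set p | h p = y] = \bigcup_k C k) ->
  exists ws, forall p q, agree ws p q -> h p = h q.
Proof.
move=> hlevel.
have [|ws wsP] := @determined_family Y (fun y => [set p | h p = y]).
  move=> y; have [r [C [HC ->]]] := hlevel y.
  have [ws wsC] :=
    determined_family (fun i => halfspace_inter_determined (HC i)).
  by exists ws => p q pq [i _ Cp]; exists i => //; apply: wsC pq Cp.
by exists ws => p q pq; apply/esym/(wsP (h p) p q).
Qed.

Lemma linear_form_freq (w : 'I_K.+1 -> rat) m (x : {ffun 'I_m.+1 -> 'I_K.+1}) :
  linear_form w (exist _ (freq R x) (freq_in_simplex R x)) =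
  ratr (\sum_i w (x i)) / m.+1%:R.
Proof.
rewrite /linear_form /= (partition_big x predT) //= rmorph_sum mulr_suml.
apply: eq_bigr => k _; rewrite ffunE mulrA; congr (_ / _).
rewrite (eq_bigr (fun=> w k)) => [|i /eqP -> //].
by rewrite sumr_const rmorphMn /= mulr_natr cardsE.
Qed.
End Determined.

Theorem theorem4p2 (R : realType) (K : nat) (Y : finType)
    (h : simplex R K -> Y)
    (hlevel : forall y : Y,
      exists (r : nat) (C : 'I_r -> set (simplex R K)),
        (forall k, finite_halfspace_inter (C k)) /\
        [set p | h p = y] = \bigcup_k C k) :
  computable h.
Proof.
have [ws ws_h] := levels_determined hlevel.
pose w (j : 'I_(size ws)) := tnth (in_tuple ws) j.
pose bits (p : simplex R K) := [ffun j => 0 < linear_form (w j) p].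
have [output outputP] : exists output, forall p, output (bits p) = h p.
  have p0 : simplex R K.
    by exists (freq R [ffun _ : 'I_1 => ord0]); exact: freq_in_simplex.
  (* sign patterns that no point realizes get the arbitrary value at p0 *)
  exists (fun b => h (xget p0 [set p | bits p = b])) => p.
  apply: ws_h => v /(nthP v)[j jws <-].
  have /ffunP/(_ (Ordinal jws)) :
      bits (xget p0 [set q | bits q = bits p]) = bits p.
    by apply: (xgetPex p0 (P := [set q | bits q = bits p])); exists p.
  by rewrite !ffunE /w !(tnth_nth v).
have [D [B [u [D_gt0 uE]]]] := integral_weights w.
have [alg algP] := threshold_computable u output.
exists alg => m N x; rewrite -outputP.
set p := exist _ _ _.
suff -> : bits p = [ffun j => (m.+1 * B < \sum_i u j (x i))%N] by exact: algP.
apply/ffunP => j; rewrite !ffunE linear_form_freq.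
rewrite pmulr_lgt0 ?invr_gt0 ?ltr0Sn //.
rewrite ltr0q -(ltr_nat rat) natr_sum natrM (eq_bigr _ (fun i _ => uE j (x i))).
rewrite big_split /= sumr_const card_ord -[B%:R *+ _]mulr_natl ltrDr -mulr_sumr.
by rewrite pmulr_rgt0 // ltr0n.
Qed.
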